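(* Let $f\colon\mathbb{R}^n\to\mathbb{R}\cup\{+\infty\}$ be a lower semi-continuous semi-algebraic function and let $S\subset\mathbb{R}^n$ be a closed semi-algebraic set such that $\mathrm{dom} f\cap S$ is nonempty and unbounded. Assume that the qualification condition at infinity $(\mathrm{QC})_\infty$ holds. Then the tangency variety $\Gamma(f,S)$ is nonempty and unbounded.
   Context: Conventions. $\|\cdot\|$ is the Euclidean norm on $\mathbb{R}^n$; $\mathbb{B}_R$ is the closed ball of radius $R>0$ centered at $0$. A subset of $\mathbb{R}^n$ is semi-algebraic if it is a finite union of sets, each defined by finitely many polynomial equalities and strict inequalities; $f\colon\mathbb{R}^n\to\mathbb{R}\cup\{+\infty\}$ is semi-algebraic if its graph $\{(x,y)\in\mathbb{R}^n\times\mathbb{R}\mid y=f(x)\}$ is. $\mathrm{dom} f=\{x\mid f(x)<+\infty\}$, $\mathrm{epi} f=\{(x,\alpha)\in\mathbb{R}^n\times\mathbb{R}\mid f(x)\le\alpha\}$. Normals and subdifferentials. For $x\in S\subset\mathbb{R}^n$, the regular normal cone $\widehat N(x;S)$ is the set of $v$ with $\langle v,x'-x\rangle\le o(\|x'-x\|)$ as $x'\to x$, $x'\in S$. The limiting normal cone $N(x;S)$ is the set of $v$ for which there are $x_k\to x$, $x_k\in S$, and $v_k\to v$ with $v_k\in\widehat N(x_k;S)$. For $x\in\mathrm{dom} f$: $\partial f(x)=\{v\mid (v,-1)\in N((x,f(x));\mathrm{epi} f)\}$ and $\partial^\infty f(x)=\{v\mid (v,0)\in N((x,f(x));\mathrm{epi}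 f)\}$. $(\mathrm{QC})_\infty$: there exists $R>0$ such that $\partial^\infty f(x)\cap(-N(x;S))=\{0\}$ for all $x\in(\mathrm{dom} f\cap S)\setminus\mathbb{B}_R$. Tangency variety: $\Gamma(f,S)=\{x\in\mathrm{dom} f\cap S\mid \exists\mu\in\mathbb{R}:\ 0\in\partial f(x)+N(x;S)+\mu x\}$. *)

(* Defs.v *)
From HB Require Import structures.
From mathcomp Require Import all_boot all_order all_algebra.
From mathcomp Require Import all_classical all_reals all_analysis.
(* Only the canonical structures of mpoly are imported: its notations clash with
   those of mathcomp-analysis. *)
From mathcomp Require Import (canonicals) mpoly.

Set Implicit Arguments.
Unset Strict Implicit.
Unset Printing Implicit Defensive.

Import Order.TTheory GRing.Theory Num.Theory.
Import numFieldNormedType.Exports.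

Local Open Scope classical_set_scope.
Local Open Scope ring_scope.

(* R^n is 'rV[R]_n.  The norm `|x| of the library on 'rV[R]_n is the sup norm;
   it induces the same topology and the same bounded sets as [enorm], so the
   library notions of limit, closed set and bounded set are used as they are. *)
Definition dotv (R : realType) (n : nat) (u v : 'rV[R]_n) : R :=
  \sum_(i < n) u ord0 i * v ord0 i.

Definition enorm (R : realType) (n : nat) (x : 'rV[R]_n) : R :=
  Num.sqrt (dotv x x).

Definition eball (R : realType) (n : nat) (r : R) : set 'rV[R]_n :=
  [set x | enorm x <= r].

(* R^n x R is identified with R^(n+1), the real coordinate coming last. *)
Definition vpair (R : realType) (n : nat) (x : 'rV[R]_n) (a : R) :
    'rV[R]_(n + 1) :=
  row_mx x (const_mx a).

Definition semialgebraic (R : realType) (n : nat) (A : set 'rV[R]_n) : Prop :=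
  exists s : seq (seq (mpoly.mpoly n R) * seq (mpoly.mpoly n R)),
    A = [set x : 'rV[R]_n | exists2 c, c \in s &
          (forall p, p \in c.1 -> mpoly.meval (fun i => x ord0 i) p = 0) /\
          (forall q, q \in c.2 -> 0 < mpoly.meval (fun i => x ord0 i) q)].

Section ExtendedRealFunctions.
Variables (R : realType) (n : nat).
Implicit Type f : 'rV[R]_n -> \bar R.

Definition dom f : set 'rV[R]_n := [set x | (f x < +oo)%E].

Definition epi f : set 'rV[R]_(n + 1) :=
  [set z | exists x a, z = vpair x a /\ (f x <= a%:E)%E].

Definition real_graph f : set 'rV[R]_(n + 1) :=
  [set z | exists x a, z = vpair x a /\ a%:E = f x].

Definition semialgebraic_fun f : Prop := semialgebraic (real_graph f).

End ExtendedRealFunctions.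

Section NormalCones.
Variables (R : realType) (n : nat).
Implicit Types (x v : 'rV[R]_n) (S : set 'rV[R]_n).

(* Both cones are empty at points outside S. *)
Definition regular_normal_cone x S : set 'rV[R]_n :=
  [set v | S x /\ forall e : R, 0 < e ->
    \forall y \near x, S y -> dotv v (y - x) <= e * enorm (y - x)].

Definition normal_cone x S : set 'rV[R]_n :=
  [set v | S x /\ exists (x_ v_ : nat -> 'rV[R]_n),
    [/\ x_ @ \oo --> x, v_ @ \oo --> v,
        forall k, S (x_ k) & forall k, regular_normal_cone (x_ k) S (v_ k)]].

End NormalCones.

Section Subdifferentials.
Variables (R : realType) (n : nat).
Implicit Types (f : 'rV[R]_n -> \bar R) (S : set 'rV[R]_n) (x : 'rV[R]_n).

(* [fine (f x)] is the real number f x when x is in dom f and f x != -oo. *)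
Definition subdiff f x : set 'rV[R]_n :=
  [set v | dom f x /\ normal_cone (vpair x (fine (f x))) (epi f) (vpair v (-1))].

Definition horizon_subdiff f x : set 'rV[R]_n :=
  [set v | dom f x /\ normal_cone (vpair x (fine (f x))) (epi f) (vpair v 0)].

Definition QC_infty f S : Prop :=
  exists2 r : R, 0 < r &
    forall x, ((dom f `&` S) `\` eball r) x ->
      horizon_subdiff f x `&` [set - v | v in normal_cone x S] = [set 0].

Definition tangency_variety f S : set 'rV[R]_n :=
  [set x | (dom f `&` S) x /\ exists mu : R,
    exists u v, [/\ subdiff f x u, normal_cone x S v & 0 = u + v + mu *: x]].

End Subdifferentials.

(* Main.v *)
Require Import Defs.
From mathcomp Require Import all_boot all_order all_algebra.
From mathcomp Require Import all_classical all_reals all_analysis.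
From mathcomp Require Import ring lra.
Set Implicit Arguments.
Unset Strict Implicit.
Unset Printing Implicit Defensive.

Import Order.TTheory GRing.Theory Num.Theory.
Import numFieldNormedType.Exports.
Local Open Scope classical_set_scope.
Local Open Scope ring_scope.

(** Let [x0] be a point of [dom f `&` S] far from the origin and [c = |x0| ^ 2].
Minimize [f x + B * (|x| ^ 2 - c) ^ 2] over the points of [S] in the shell
[| |x| ^ 2 - c | <= 1].  A minimizer exists since the shell is compact and [f]
is lower semicontinuous; as [f] is bounded below on the shell, a large [B] makes
the cost on its boundary exceed [f x0], the value at [x0], so the minimizer [x]
is interior ([shell_minimizer]).  Hence [x] is an unconstrained local minimizer
over [S] of [f] plus a smooth function whose gradient at [x] is a multiple
[mu *: x].  The first-order condition for this problem,
[0 \in subdiff f x + normal_cone x S + mu *: x], is the tangency relation; and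
[|x| ^ 2 > c - 1] makes the points so obtained unbounded.  Minimizing over a
shell instead of a sphere keeps the sphere out of the constraints: on a sphere,
the multipliers could be carried by the sphere, [S] and [dom f] alone, with none
left for [f], and the qualification condition would not exclude this.

The first-order condition is a sum rule for limiting normals.  It is obtained
from a Fritz John theorem ([fritz_john]) for the minimum of a smooth function
over an intersection of two closed sets, here [epi f] and the cylinder above
[S]: some multipliers [(lam, om) != 0] satisfy [lam >= 0],
[- lam *: G z - om \in N(z; C)] and [om \in N(z; D)].  Its proof relaxes
[a \in C `&` D] to pairs [(a, b)] with a quadratic penalty on [a - b], applies
Fermat's rule to each variable separately, and passes to the limit after
normalizing the multipliers.  When [lam = 0], the vector [om] contradicts the
qualification condition ([tangency_point_beyond]). *)

(** * Euclidean norm against the norm of the topology *)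

Lemma dotvC (R : realType) n (u v : 'rV[R]_n) : dotv u v = dotv v u.
Proof. by apply: eq_bigr => i _; rewrite mulrC. Qed.

Lemma dotvDl (R : realType) n (u v w : 'rV[R]_n) :
  dotv (u + v) w = dotv u w + dotv v w.
Proof. by rewrite -big_split; apply: eq_bigr => i _; rewrite mxE mulrDl. Qed.

Lemma dotvZl (R : realType) n (a : R) (u w : 'rV[R]_n) :
  dotv (a *: u) w = a * dotv u w.
Proof. by rewrite mulr_sumr; apply: eq_bigr => i _; rewrite mxE mulrA. Qed.

Lemma dotvNl (R : realType) n (u w : 'rV[R]_n) : dotv (- u) w = - dotv u w.
Proof. by rewrite -scaleN1r dotvZl mulN1r. Qed.

Lemma dotv0l (R : realType) n (w : 'rV[R]_n) : dotv 0 w = 0.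
Proof. by rewrite -(scale0r 0) dotvZl mul0r. Qed.

Lemma dotvBl (R : realType) n (u v w : 'rV[R]_n) :
  dotv (u - v) w = dotv u w - dotv v w.
Proof. by rewrite dotvDl dotvNl. Qed.

Lemma dotvDr (R : realType) n (u v w : 'rV[R]_n) :
  dotv w (u + v) = dotv w u + dotv w v.
Proof. by rewrite dotvC dotvDl !(dotvC w). Qed.

Lemma dotv_ge0 (R : realType) n (x : 'rV[R]_n) : 0 <= dotv x x.
Proof. by apply: sumr_ge0 => i _; rewrite -expr2 sqr_ge0. Qed.

Lemma enorm_ge0 (R : realType) n (x : 'rV[R]_n) : 0 <= enorm x.
Proof. exact: sqrtr_ge0. Qed.

Lemma sqr_enorm (R : realType) n (x : 'rV[R]_n) : enorm x ^+ 2 = dotv x x.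
Proof. by rewrite sqr_sqrtr // dotv_ge0. Qed.

Lemma coord_le_norm (R : realType) n (x : 'rV[R]_n) i : `|x ord0 i| <= `|x|.
Proof.
rewrite [leRHS]/Num.Def.normr /= mx_normrE.
by apply/bigmax_geP; right; exists (ord0, i).
Qed.

Lemma norm_le_coord (R : realType) n (x : 'rV[R]_n) (M : R) : 0 <= M ->
  (forall i, `|x ord0 i| <= M) -> `|x| <= M.
Proof.
move=> M0 xM; rewrite [leLHS]/Num.Def.normr /= mx_normrE.
by apply/bigmax_leP; split => // -[i j] _ /=; rewrite (ord1 i).
Qed.

Lemma norm_le_enorm (R : realType) n (x : 'rV[R]_n) : `|x| <= enorm x.
Proof.
apply: norm_le_coord => [|i]; first exact: enorm_ge0.
rewrite -(@ler_pXn2r _ 2) ?nnegrE ?enorm_ge0 // sqr_enorm real_normK ?num_real //.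
rewrite /dotv (bigD1 i) //= -expr2 lerDl.
by apply: sumr_ge0 => j _; rewrite -expr2 sqr_ge0.
Qed.

Lemma dotv_le (R : realType) n (u v : 'rV[R]_n) :
  `|dotv u v| <= n%:R * (`|u| * `|v|).
Proof.
apply: (le_trans (ler_norm_sum _ _ _)).
rewrite -[n in n%:R]card_ord -sum1_card natr_sum mulr_suml.
by apply: ler_sum => i _; rewrite mul1r normrM ler_pM // coord_le_norm.
Qed.

Lemma dotv_eq0 (R : realType) n (x : 'rV[R]_n) : dotv x x <= 0 -> x = 0.
Proof.
move=> x0; apply/eqP; rewrite -normr_le0.
apply: (le_trans (norm_le_enorm _)).
by rewrite /enorm ler0_sqrtr.
Qed.

Lemma cvg_dotv (R : realType) n (T : topologicalType) (f g : T -> 'rV[R]_n) (t : T) :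
  {for t, continuous f} -> {for t, continuous g} ->
  {for t, continuous (fun s => dotv (f s) (g s))}.
Proof.
move=> cf cg; apply: cvg_big => [|i _]; first exact: add_continuous.
by apply: cvgM;
  (apply: (@continuous_comp _ _ _ _ (fun x : 'rV[R]_n => x ord0 i));
   [by []|exact: coord_continuous]).
Qed.

(** * Regular and limiting normals *)

(** The one-sided first-order expansion is all that a minimality argument
needs to produce a regular normal, see [regular_normal_of_local_min]. *)
Definition upper_gradient (R : realType) n (h : 'rV[R]_n -> R) (x g : 'rV[R]_n) :=
  forall e : R, 0 < e ->
    \forall y \near x, h y <= h x + dotv g (y - x) + e * enorm (y - x).

Lemma upper_gradientD (R : realType) n (h k : 'rV[R]_n -> R) (x u v : 'rV[R]_n) :
  upper_gradient h x u -> upper_gradient k x v ->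
  upper_gradient (fun y => h y + k y) x (u + v).
Proof.
move=> hu kv e e0.
have e2 : 0 < e / 2 by rewrite divr_gt0.
near=> y; rewrite dotvDl.
have hy : h y <= h x + dotv u (y - x) + e / 2 * enorm (y - x).
  by near: y; exact: hu.
have ky : k y <= k x + dotv v (y - x) + e / 2 * enorm (y - x).
  by near: y; exact: kv.
lra.
Unshelve. all: by end_near. Qed.

Lemma upper_gradient_quadratic (R : realType) n (h : 'rV[R]_n -> R)
    (x g : 'rV[R]_n) (M : R) :
  (\forall y \near x, h y <= h x + dotv g (y - x) + M * dotv (y - x) (y - x)) ->
  upper_gradient h x g.
Proof.
move=> hM e e0.
have M1 : 0 < `|M| + 1 by rewrite ltr_wpDl.
have cB : {for x, continuous (fun y : 'rV[R]_n => y - x)}.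
  by apply: (@continuousB _ _ _ id (fun=> x)); [exact: cvg_id|exact: cst_continuous].
have c0 : dotv (y - x) (y - x) @[y --> x] --> (0 : R).
  have -> : 0 = dotv (x - x) (x - x) :> R by rewrite subrr dotv0l.
  exact: (cvg_dotv cB cB).
have d0 : 0 < (e / (`|M| + 1)) ^+ 2 by rewrite exprn_gt0 ?divr_gt0.
near=> y.
have hy : h y <= h x + dotv g (y - x) + M * dotv (y - x) (y - x) by near: y.
apply: (le_trans hy); rewrite lerD2l -sqr_enorm.
have : enorm (y - x) ^+ 2 <= (e / (`|M| + 1)) ^+ 2.
  rewrite sqr_enorm; apply: (le_trans (ler_norm _)).
  rewrite -[X in `|X|]subr0; near: y.
  exact: (cvgr_distC_le _ _ c0).
have r0 : 0 <= e / (`|M| + 1) by rewrite divr_ge0 // ltW.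
rewrite ler_pXn2r ?nnegrE ?enorm_ge0 //.
rewrite ler_pdivlMr // => dM.
rewrite expr2 mulrA ler_wpM2r ?enorm_ge0 //.
apply: (le_trans _ dM); rewrite mulrC ler_wpM2l ?enorm_ge0 //.
by rewrite (le_trans (ler_norm _)) // lerDl.
Unshelve. all: by end_near. Qed.

Lemma upper_gradient_sqr_dist (R : realType) n (c : R) (a x : 'rV[R]_n) :
  upper_gradient (fun y => c / 2 * dotv (y - a) (y - a)) x (c *: (x - a)).
Proof.
apply: (@upper_gradient_quadratic _ _ _ _ _ (c / 2)); near=> y.
rewrite (_ : y - a = (y - x) + (x - a)); last by rewrite addrA subrK.
move: (y - x) (x - a) => d b.
by rewrite !(dotvDl, dotvDr, dotvZl) (dotvC d b); lra.
Unshelve. all: by end_near. Qed.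

(** Fermat's rule: [h] cannot decrease to first order on [C], so that near [x]
the set [C] lies to first order in the half-space where [g] is nonnegative. *)
Lemma regular_normal_of_local_min (R : realType) n (C : set 'rV[R]_n)
    (h : 'rV[R]_n -> R) (x g : 'rV[R]_n) :
  C x -> (\forall y \near x, C y -> h x <= h y) -> upper_gradient h x g ->
  regular_normal_cone x C (- g).
Proof.
move=> Cx hmin hg; split=> // e e0; near=> y => Cy.
have : h x <= h y by move: Cy; near: y.
have : h y <= h x + dotv g (y - x) + e * enorm (y - x) by near: y; exact: hg.
by rewrite dotvNl; lra.
Unshelve. all: by end_near. Qed.

Lemma regular_normal_coneZ (R : realType) n (C : set 'rV[R]_n)
    (x v : 'rV[R]_n) (t : R) : 0 <= t ->
  regular_normal_cone x C v -> regular_normal_cone x C (t *: v).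
Proof.
rewrite le_eqVlt => /predU1P[<-|t0] [Cx vC]; split=> // e e0.
  near=> y => _; rewrite scale0r dotv0l.
  by rewrite mulr_ge0 ?enorm_ge0 ?ltW.
near=> y => Cy; rewrite dotvZl mulrC -ler_pdivlMr // mulrAC.
by move: Cy; near: y; apply: vC; rewrite divr_gt0.
Unshelve. all: by end_near. Qed.

(** Replacing sequences by arbitrarily good approximations lets limiting
normals be produced from cluster points, with no extraction of subsequences. *)
Lemma normal_coneP (R : realType) n (S : set 'rV[R]_n) (x v : 'rV[R]_n) :
  normal_cone x S v <->
  S x /\ forall e : R, 0 < e -> exists x' v',
    [/\ `|x' - x| < e, `|v' - v| < e & regular_normal_cone x' S v'].
Proof.
split=> [[Sx [x_ [v_ [cx cv Sx_ Nv_]]]]|[Sx approx]]; split=> //.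
  move=> e e0.
  have [k [xk vk]] : exists k, `|x_ k - x| < e /\ `|v_ k - v| < e.
    apply: (@filter_ex _ \oo); near=> k; split.
      by near: k; exact: (cvgr_distC_lt _ _ cx).
    by near: k; exact: (cvgr_distC_lt _ _ cv).
  by exists (x_ k), (v_ k).
have /choice[p pP] : forall k : nat, exists p : 'rV[R]_n * 'rV[R]_n,
    [/\ `|p.1 - x| < k.+1%:R^-1, `|p.2 - v| < k.+1%:R^-1
      & regular_normal_cone p.1 S p.2].
  move=> k; have [|x' [v' ?]] := approx k.+1%:R^-1; first by rewrite invr_gt0.
  by exists (x', v').
have squeeze (u_ : nat -> 'rV[R]_n) u :
    (forall k, `|u_ k - u| < k.+1%:R^-1) -> u_ @ \oo --> u.
  move=> uk; apply/cvgrPdistC_lt => e e0; near=> k.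
  apply: (lt_trans (uk k)); near: k; exact: near_infty_natSinv_lt (PosNum e0).
exists (fst \o p), (snd \o p); split.
- by apply: squeeze => k; case: (pP k).
- by apply: squeeze => k; case: (pP k).
- by move=> k; case: (pP k) => _ _ [].
- by move=> k; case: (pP k).
Unshelve. all: by end_near. Qed.

Lemma normal_coneZ (R : realType) n (S : set 'rV[R]_n) (x v : 'rV[R]_n) (t : R) :
  0 < t -> normal_cone x S v -> normal_cone x S (t *: v).
Proof.
move=> t0 /normal_coneP[Sx approx]; apply/normal_coneP; split=> // e e0.
have [|x' [v' [xx' vv' N]]] := approx (Num.min e (e / t)).
  by rewrite lt_min e0 divr_gt0.
move: xx' vv'; rewrite !lt_min => /andP[xx' _] /andP[_ vv'].
exists x', (t *: v'); split=> //.
  by rewrite -scalerBr normrZ gtr0_norm // mulrC -ltr_pdivlMr.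
exact: regular_normal_coneZ (ltW t0) N.
Qed.

(** * Multipliers for a minimum over an intersection *)

Lemma compact_seq_cluster (T : topologicalType) (K : set T) (u : nat -> T) :
  compact K -> (forall k, K (u k)) ->
  exists2 p, K p & forall U, nbhs p U -> forall N, exists2 k, (N <= k)%N & U (u k).
Proof.
move=> cK uK; have [|p [Kp clp]] := cK (u @ \oo) _.
  by exists 0%N => // k _; exact: uK.
exists p => // U pU N.
have [|_ [[k Nk <-] Uk]] := clp (u @` [set k | (N <= k)%N]) U _ pU.
  by exists N => // k Nk; exists k.
by exists k.
Qed.

Lemma closed_sublevel (R : realType) (T : topologicalType) (h : T -> R) (c : R) :
  continuous h -> closed [set x | h x <= c].
Proof.
move=> ch; apply: (@preimage_closed _ _ h [set t | t <= c]).
  by move=> x _; exact: ch.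
exact: closed_le.
Qed.

Lemma compact_ball (R : realType) n (z : 'rV[R]_n) (r : R) :
  compact [set y : 'rV[R]_n | `|y - z| <= r].
Proof.
apply: bounded_closed_compact.
  exists (r + `|z|); split; first exact: num_real.
  move=> M rM y /= yz; apply: (le_trans _ (ltW rM)).
  by rewrite -[y](subrK z) (le_trans (ler_normD _ _)) // lerD2r.
apply: closed_sublevel => y.
apply: (@continuous_comp _ _ _ (fun y : 'rV[R]_n => y - z)).
  by apply: (@continuousB _ _ _ id (fun=> z)); [exact: cvg_id|exact: cst_continuous].
exact: norm_continuous.
Qed.

(** The constraint [a \in C `&` D] is relaxed to a pair [(a, b)] in [C `*` D]
tied by the penalty [k / 2 * |a - b| ^ 2]. *)
Definition penalized (R : realType) n (psi : 'rV[R]_n -> R) (z : 'rV[R]_n)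
    (k : R) (a b : 'rV[R]_n) : R :=
  psi a + 1 / 2 * dotv (a - z) (a - z) + k / 2 * dotv (a - b) (a - b).

Lemma penalized_continuous (R : realType) n (psi : 'rV[R]_n -> R)
    (z : 'rV[R]_n) (k : R) :
  continuous psi ->
  continuous (fun p : 'rV[R]_n * 'rV[R]_n => penalized psi z k p.1 p.2).
Proof.
move=> cpsi p.
have c1 : {for p, continuous (fun q : 'rV[R]_n * 'rV[R]_n => q.1)} by exact: cvg_fst.
have c2 : {for p, continuous (fun q : 'rV[R]_n * 'rV[R]_n => q.2)} by exact: cvg_snd.
have c1z : {for p, continuous (fun q : 'rV[R]_n * 'rV[R]_n => q.1 - z)}.
  by apply: (@continuousB _ _ _ fst (fun=> z)) => //; exact: cst_continuous.
have c12 : {for p, continuous (fun q : 'rV[R]_n * 'rV[R]_n => q.1 - q.2)}.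
  exact: (@continuousB _ _ _ fst snd).
apply: cvgD; first apply: cvgD.
- exact: (continuous_comp c1 (cpsi _)).
- by apply: cvgM; [exact: cvg_cst|exact: (cvg_dotv c1z c1z)].
- by apply: cvgM; [exact: cvg_cst|exact: (cvg_dotv c12 c12)].
Qed.

(** As the penalty grows, the minimizers of the relaxed problem come together,
hence accumulate at feasible points where [psi] plus the proximal term is at
most [psi z]; the proximal term leaves [z] as the only such point.  Once close
to [z], they are unaffected by the localization to a ball. *)
Lemma penalized_minimizers (R : realType) n (C D : set 'rV[R]_n)
    (psi : 'rV[R]_n -> R) (z : 'rV[R]_n) (e : R) :
  closed C -> closed D -> continuous psi -> C z -> D z ->
  (\forall y \near z, C y -> D y -> psi z <= psi y) -> 0 < e ->
  exists k x y, [/\ C x, D y, `|x - z| < e /\ `|y - z| < e,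
    \forall a \near x, C a -> penalized psi z k x y <= penalized psi z k a y &
    \forall b \near y, D b -> penalized psi z k x y <= penalized psi z k x b].
Proof.
move=> clC clD cpsi Cz Dz /nbhs_ballP[r0 /= r00 zmin] e0.
pose r := r0 / 2; have r_gt0 : 0 < r by rewrite divr_gt0.
pose B := [set y : 'rV[R]_n | `|y - z| <= r].
have Bz : B z by rewrite /B /= subrr normr0 ltW.
have cK : compact ((C `&` B) `*` (D `&` B)).
  by apply: compact_setX; rewrite setIC;
    apply: compact_closedI => //; exact: compact_ball.
have /choice[p pP] : forall k : nat, exists p : 'rV[R]_n * 'rV[R]_n,
    ((C `&` B) `*` (D `&` B)) p /\
    forall q, ((C `&` B) `*` (D `&` B)) q ->
      penalized psi z k%:R p.1 p.2 <= penalized psi z k%:R q.1 q.2.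
  move=> k.
  have [|//||p /set_mem pK pmin] := @compact_EVT_min _ R
    (fun q => penalized psi z k%:R q.1 q.2) ((C `&` B) `*` (D `&` B)).
  - by exists (z, z).
  - by apply: continuous_subspaceT; exact: penalized_continuous.
  - by exists p; split=> // q /mem_set; exact: pmin.
have pz k : penalized psi z k%:R (p k).1 (p k).2 <= psi z.
  have [_ /(_ (z, z))] := pP k.
  by rewrite {2}/penalized /= subrr dotv0l !mulr0 !addr0; apply.
have [[a b] [[Ca Ba] [Db Bb]] cl] :=
  compact_seq_cluster cK (fun k => (pP k).1).
rewrite /= in Ca Ba Db Bb.
have ab : a = b.
  apply/eqP; rewrite -subr_eq0; apply/eqP/dotv_eq0; rewrite leNgt; apply/negP => d0.
  set d := dotv _ _ in d0.
  have near_psi : \forall q \near (a, b), penalized psi z 0 q.1 q.2 > psi a - 1.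
    have c := @penalized_continuous _ _ _ z 0 cpsi (a, b).
    apply: (cvgr_gt _ c) => /=.
    rewrite /penalized !mul0r addr0 mul1r.
    have := dotv_ge0 (a - z); lra.
  have near_d : \forall q \near (a, b), dotv (q.1 - q.2) (q.1 - q.2) > d / 2.
    have c12 : {for (a, b), continuous (fun q : 'rV[R]_n * 'rV[R]_n => q.1 - q.2)}.
      by apply: (@continuousB _ _ _ fst snd); [exact: cvg_fst|exact: cvg_snd].
    apply: (cvgr_gt _ (cvg_dotv c12 c12)) => /=.
    by rewrite -/d; lra.
  pose M := psi z - psi a + 1.
  have [N _ MN] := nbhs_infty_ger (4 * `|M| / d).
  have [k Nk [k1 k2]] := cl _ (filterI near_psi near_d) N.
  have := pz k; have := MN k Nk; rewrite /= ler_pdivrMr //.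
  move: k1 k2; rewrite /penalized !mul0r addr0.
  set t := dotv (_ - (p k).2) _ => k1 k2 k3 k4.
  have kt : k%:R * (d / 2) <= k%:R * t by rewrite ler_wpM2l // ltW.
  have MM : M <= `|M| by exact: ler_norm.
  move: MM; rewrite {1}/M; lra.
have az : a = z.
  apply/eqP; rewrite -subr_eq0; apply/eqP/dotv_eq0; rewrite leNgt; apply/negP => d0.
  have near_psi : \forall q \near (a, b), penalized psi z 0 q.1 q.2 > psi z.
    have c := @penalized_continuous _ _ _ z 0 cpsi (a, b).
    apply: (cvgr_gt _ c) => /=.
    have : psi z <= psi a.
      apply: zmin => //; last by rewrite ab.
      rewrite -ball_normE /= distrC; apply: (le_lt_trans Ba).
      by rewrite /r; lra.
    rewrite /penalized !mul0r addr0; lra.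
  have [k _ k1] := cl _ near_psi 0%N.
  have := pz k; have := dotv_ge0 ((p k).1 - (p k).2).
  move: k1; rewrite /penalized !mul0r addr0.
  set t := dotv (_ - (p k).2) _ => k1 k2 k3.
  have : 0 <= k%:R * t by rewrite mulr_ge0.
  lra.
subst b; subst a.
have m0 : 0 < Num.min e r by rewrite lt_min e0.
have near_z : \forall q \near (z, z),
    ball z (Num.min e r) q.1 /\ ball z (Num.min e r) q.2.
  by exists (ball z (Num.min e r), ball z (Num.min e r)) => //;
    split; exact: nbhsx_ballx.
have [k _ [kx ky]] := cl _ near_z 0%N.
have inside (w : 'rV[R]_n) : ball z (Num.min e r) w ->
    `|w - z| < e /\ \forall v \near w, B v.
  rewrite -ball_normE /= distrC lt_min => /andP[we wr]; split=> //.
  near=> v; rewrite /B /= ltW // -[v](subrK w) -addrA.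
  apply: (le_lt_trans (ler_normD _ _)).
  rewrite -ltrBrDr distrC; near: v.
  by apply: cvgr_dist_lt; rewrite ?subr_gt0.
have [xe Bx] := inside _ kx; have [ye By] := inside _ ky.
have [[[Cx Bx'] [Dy By']] kmin] := pP k.
exists k%:R, (p k).1, (p k).2; split=> //.
- by near=> v => Cv; apply: (kmin (v, _)); split=> //; split=> //; near: v.
- by near=> v => Dv; apply: (kmin (_, v)); split=> //; split=> //; near: v.
Unshelve. all: by end_near. Qed.

(** Fermat's rule in each variable of the relaxed problem: the penalty
contributes the same vector [k *: (x - y)] with opposite signs, while the
proximal term only perturbs the gradient by [x - z]. *)
Lemma fuzzy_multipliers (R : realType) n (C D : set 'rV[R]_n)
    (psi : 'rV[R]_n -> R) (G : 'rV[R]_n -> 'rV[R]_n) (z : 'rV[R]_n) (e : R) :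
  closed C -> closed D -> continuous psi -> C z -> D z ->
  (forall x, upper_gradient psi x (G x)) -> {for z, continuous G} ->
  (\forall y \near z, C y -> D y -> psi z <= psi y) -> 0 < e ->
  exists x y g w, [/\ `|x - z| < e, `|y - z| < e, `|g - G z| < e,
    regular_normal_cone x C (- g - w) & regular_normal_cone y D w].
Proof.
move=> clC clD cpsi Cz Dz psiG cG zmin e0.
have e2 : 0 < e / 2 by rewrite divr_gt0.
have [d /= d0 dG] := (nbhs_ballP _ _).1 (cvgr_distC_lt _ _ cG _ e2).
have d1 : 0 < Num.min d (e / 2) by rewrite lt_min d0.
have [k [x [y [Cx Dy [xz yz] xmin ymin]]]] :=
  penalized_minimizers clC clD cpsi Cz Dz zmin d1.
move: xz yz; rewrite !lt_min => /andP[xd xe] /andP[_ ye].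
exists x, y, (G x + 1 *: (x - z)), (k *: (x - y)); split.
- by apply: (lt_trans xe); lra.
- by apply: (lt_trans ye); lra.
- rewrite addrAC scale1r; apply: (le_lt_trans (ler_normD _ _)).
  have : `|G x - G z| < e / 2.
    by apply: dG; rewrite -ball_normE /= distrC.
  lra.
- rewrite -opprD; apply: (regular_normal_of_local_min Cx xmin).
  by apply: upper_gradientD; [apply: upper_gradientD|];
    [exact: psiG|exact: upper_gradient_sqr_dist|exact: upper_gradient_sqr_dist].
- rewrite -[_ *: _]opprK -scalerN opprB.
  apply: (regular_normal_of_local_min (h := penalized psi z k x) Dy ymin).
  have -> : penalized psi z k x =
      fun b => (psi x + 1 / 2 * dotv (x - z) (x - z)) + k / 2 * dotv (b - x) (b - x).
    apply/funext => b; rewrite /penalized -(opprB x b).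
    by rewrite !(dotvNl, dotvC _ (- _)) opprK.
  rewrite -[k *: _]add0r; apply: upper_gradientD.
    move=> t t0; near=> b.
    by rewrite dotv0l addr0 lerDl mulr_ge0 ?enorm_ge0 ?ltW.
  exact: upper_gradient_sqr_dist.
Unshelve. all: by end_near. Qed.

(** The multipliers [w] of [fuzzy_multipliers] may blow up as the
approximation improves, so the pair [(1, w)] is rescaled to [(1 - |om|, om)]
with [om = w / (1 + |w|)], which ranges over the compact unit ball. *)
Lemma fritz_john (R : realType) n (C D : set 'rV[R]_n)
    (psi : 'rV[R]_n -> R) (G : 'rV[R]_n -> 'rV[R]_n) (z : 'rV[R]_n) :
  closed C -> closed D -> continuous psi -> C z -> D z ->
  (forall x, upper_gradient psi x (G x)) -> {for z, continuous G} ->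
  (\forall y \near z, C y -> D y -> psi z <= psi y) ->
  exists lam om, [/\ 0 <= lam, lam + `|om| = 1,
    normal_cone z C (- (lam *: G z) - om) & normal_cone z D om].
Proof.
move=> clC clD cpsi Cz Dz psiG cG zmin.
have /choice[w wP] : forall k : nat, exists w : 'rV[R]_n, exists x y g,
    [/\ `|x - z| < k.+1%:R^-1, `|y - z| < k.+1%:R^-1, `|g - G z| < k.+1%:R^-1,
    regular_normal_cone x C (- g - w) & regular_normal_cone y D w].
  move=> k; have [|x [y [g [w ?]]]] :=
    fuzzy_multipliers clC clD cpsi Cz Dz psiG cG zmin (e := k.+1%:R^-1).
    by rewrite invr_gt0.
  by exists w, x, y, g.
pose t k := (1 + `|w k|)^-1.
have w1 k : 0 < 1 + `|w k| by rewrite ltr_pwDl.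
have t0 k : 0 < t k by rewrite invr_gt0.
have t1 k : t k <= 1 by rewrite invf_le1 // lerDl.
pose om k := t k *: w k.
have omN k : `|om k| = 1 - t k.
  by rewrite normrZ gtr0_norm // /t; field; rewrite lt0r_neq0.
have [k|om0 om0B cl] := @compact_seq_cluster _ _ om (@compact_ball R n 0 1).
  by rewrite /= subr0 omN; have := t0 k; lra.
rewrite /= subr0 in om0B.
have approx (e : R) : 0 < e -> exists k x y g,
    [/\ `|x - z| < e, `|y - z| < e, `|g - G z| < e & `|om k - om0| < e] /\
    regular_normal_cone x C (- (t k *: g) - om k) /\ regular_normal_cone y D (om k).
  move=> e0.
  have [N _ Ne] := near_infty_natSinv_lt (PosNum e0).
  have [k Nk komB] := cl _ (nbhsx_ballx om0 e e0) N.
  have ke : k.+1%:R^-1 < e by exact: Ne.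
  have [x [y [g [xz yz gz NC ND]]]] := wP k.
  exists k, x, y, g; split; last split.
  - split; [exact: lt_trans xz ke|exact: lt_trans yz ke|exact: lt_trans gz ke|].
    by move: komB; rewrite -ball_normE /= distrC.
  - rewrite /om -scalerN -scalerBr.
    exact: regular_normal_coneZ (ltW (t0 k)) NC.
  - exact: regular_normal_coneZ (ltW (t0 k)) ND.
exists (1 - `|om0|), om0; split; first by rewrite subr_ge0.
- by rewrite subrK.
- apply/normal_coneP; split=> // e e0.
  have c0 : 0 < `|G z| + 2 by rewrite ltr_wpDl.
  have d0 : 0 < e / (`|G z| + 2) by rewrite divr_gt0.
  have [k [x [y [g [[xz yz gz omk] [NC ND]]]]]] := approx _ d0.
  set d := e / _ in d0 xz gz omk.
  have de : d * (`|G z| + 2) = e by rewrite divfK // lt0r_neq0.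
  exists x, (- (t k *: g) - om k); split=> //.
    apply: (lt_le_trans xz); rewrite -de ler_peMr ?ltW //.
    by have := normr_ge0 (G z); lra.
  (* the error splits as [- t (g - G) - (t - lam) G - (om k - om0)] *)
  rewrite (_ : _ - _ = - (t k *: (g - G z)) -
      ((`|om0| - `|om k|) *: G z) - (om k - om0)); last first.
    have -> : t k = 1 - `|om k| by rewrite omN; lra.
    by apply/rowP => i; rewrite !mxE; ring.
  rewrite -de mulrDr; apply: (le_lt_trans (ler_normB _ _)).
  have : `|- (t k *: (g - G z)) - (`|om0| - `|om k|) *: G z| <= d + d * `|G z|.
    apply: (le_trans (ler_normB _ _)); rewrite normrN; apply: lerD; rewrite normrZ.
      rewrite gtr0_norm // (le_trans _ (ltW gz)) //.
      by rewrite ler_piMl.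
    rewrite ler_wpM2r // (le_trans (ler_dist_dist _ _)) //.
    by rewrite distrC ltW.
  lra.
- apply/normal_coneP; split=> // e e0.
  have [k [x [y [g [[_ yz _ omk] [_ ND]]]]]] := approx _ e0.
  by exists y, (om k).
Unshelve. all: by end_near. Qed.

(** * Epigraphs and cylinders *)

Definition height (R : realType) n (z : 'rV[R]_(n + 1)) : R :=
  z ord0 (rshift n ord0).

Lemma lsubmx_vpair (R : realType) n (x : 'rV[R]_n) (a : R) :
  lsubmx (vpair x a) = x.
Proof. exact: row_mxKl. Qed.

Lemma height_vpair (R : realType) n (x : 'rV[R]_n) (a : R) :
  height (vpair x a) = a.
Proof. by rewrite /height row_mxEr mxE. Qed.

Lemma vpairK (R : realType) n (z : 'rV[R]_(n + 1)) :
  vpair (lsubmx z) (height z) = z.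
Proof.
rewrite -[RHS]hsubmxK; congr row_mx.
by apply/rowP => i; rewrite !mxE (ord1 i).
Qed.

Lemma vpairB (R : realType) n (x y : 'rV[R]_n) (a b : R) :
  vpair x a - vpair y b = vpair (x - y) (a - b).
Proof.
rewrite /vpair opp_row_mx add_row_mx; congr row_mx.
by apply/rowP => i; rewrite !mxE.
Qed.

Lemma vpairZ (R : realType) n (t : R) (x : 'rV[R]_n) (a : R) :
  t *: vpair x a = vpair (t *: x) (t * a).
Proof.
rewrite /vpair scale_row_mx; congr row_mx.
by apply/rowP => i; rewrite !mxE.
Qed.

Lemma dotv_vpair (R : realType) n (x y : 'rV[R]_n) (a b : R) :
  dotv (vpair x a) (vpair y b) = dotv x y + a * b.
Proof.
rewrite /dotv big_split_ord big_ord1; congr +%R; last first.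
  by rewrite !row_mxEr !mxE.
by apply: eq_bigr => i _; rewrite !row_mxEl.
Qed.

Lemma norm_lsubmx (R : realType) n (z : 'rV[R]_(n + 1)) : `|lsubmx z| <= `|z|.
Proof. by apply: norm_le_coord => // i; rewrite mxE coord_le_norm. Qed.

Lemma norm_vpair (R : realType) n (x : 'rV[R]_n) (a M : R) :
  `|x| <= M -> `|a| <= M -> `|vpair x a| <= M.
Proof.
move=> xM aM; apply: norm_le_coord; first exact: le_trans aM.
move=> i; rewrite -[i]splitK; case: (fintype.split i) => j /=.
  by rewrite row_mxEl (le_trans (coord_le_norm _ _)).
by rewrite row_mxEr mxE.
Qed.

Lemma height_continuous (R : realType) n : continuous (@height R n).
Proof. by move=> z; exact: coord_continuous. Qed.

Lemma near_vpair (R : realType) n (P : set 'rV[R]_(n + 1)) (x : 'rV[R]_n) (a : R) :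
  nbhs (vpair x a) P -> exists2 d : R, 0 < d &
    forall y b, `|y - x| < d -> `|b - a| < d -> P (vpair y b).
Proof.
move=> /nbhs_ballP[d /= d0 dP]; exists (d / 2); first by rewrite divr_gt0.
move=> y b yx ba; apply: dP; rewrite -ball_normE /= distrC vpairB.
apply: (@le_lt_trans _ _ (d / 2)); last by lra.
by apply: norm_vpair; exact: ltW.
Qed.

(** Moving along the height stays in the cylinder in both directions, so a
regular normal has no component there. *)
Lemma regular_normal_cylinder (R : realType) n (S : set 'rV[R]_n)
    (z w : 'rV[R]_(n + 1)) :
  regular_normal_cone z [set y | S (lsubmx y)] w ->
  regular_normal_cone (lsubmx z) S (lsubmx w) /\ height w = 0.
Proof.
rewrite -{1}[z]vpairK -{1}[w]vpairK.
move: (lsubmx z) (height z) (lsubmx w) (height w) => x a v b [].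
rewrite /= lsubmx_vpair => Sx N; split; first split=> // e e0.
  have [d d0 dN] := near_vpair (N e e0).
  near=> y => Sy.
  have yx : `|y - x| < d by near: y; apply: cvgr_distC_lt.
  have := dN y a yx; rewrite subrr normr0 /= lsubmx_vpair vpairB subrr.
  rewrite /enorm !dotv_vpair !mulr0 !addr0; exact.
apply/eqP/negP => /negP b0.
have [|d d0 dN] := @near_vpair _ _ _ x a (N (`|b| / 2) _).
  by rewrite divr_gt0 // normr_gt0.
pose s := Num.sg b * (d / 2).
have sE : `|s| = d / 2.
  by rewrite normrM normr_sg b0 mul1r gtr0_norm // divr_gt0.
have bs : b * s = `|b| * (d / 2) by rewrite mulrA [b * _]mulrC -normrEsg.
have bd : 0 < `|b| * d by rewrite mulr_gt0 // normr_gt0.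
have shiftE : a + s - a = s by rewrite addrC addKr.
have := dN x (a + s); rewrite subrr normr0 shiftE sE /= lsubmx_vpair vpairB subrr shiftE.
rewrite /enorm !dotv_vpair (dotvC v) !dotv0l !add0r bs -expr2 sqrtr_sqr sE.
by move=> /(_ d0 _ Sx); lra.
Unshelve. all: by end_near. Qed.

Lemma normal_cylinder (R : realType) n (S : set 'rV[R]_n) (z w : 'rV[R]_(n + 1)) :
  normal_cone z [set y | S (lsubmx y)] w ->
  normal_cone (lsubmx z) S (lsubmx w) /\ height w = 0.
Proof.
move=> /normal_coneP[/= Sz approx]; split.
  apply/normal_coneP; split=> // e e0.
  have [z' [w' [zz ww /regular_normal_cylinder[N _]]]] := approx e e0.
  exists (lsubmx z'), (lsubmx w'); split=> //.
    by rewrite -linearB (le_lt_trans (norm_lsubmx _)).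
  by rewrite -linearB (le_lt_trans (norm_lsubmx _)).
apply/eqP; rewrite -normr_le0 leNgt; apply/negP => w0.
have [z' [w' [_ ww /regular_normal_cylinder[_ h0]]]] := approx _ w0.
have := coord_le_norm (w' - w) (rshift n ord0).
rewrite !mxE -/(height w') -/(height w) h0 sub0r normrN => /le_lt_trans/(_ ww).
by rewrite ltxx.
Qed.

Lemma epiE (R : realType) n (f : 'rV[R]_n -> \bar R) (z : 'rV[R]_(n + 1)) :
  epi f z <-> (f (lsubmx z) <= (height z)%:E)%E.
Proof.
split=> [[x [a [-> fx]]]|fz]; first by rewrite lsubmx_vpair height_vpair.
by exists (lsubmx z), (height z); rewrite vpairK.
Qed.

Lemma epi_closed (R : realType) n (f : 'rV[R]_n -> \bar R) :
  lower_semicontinuous f -> closed (epi f).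
Proof.
move=> flsc z clz; apply/epiE; rewrite leNgt; apply/negP => zf.
have [c zc cf] : exists2 c : R, height z < c & (c%:E < f (lsubmx z))%E.
  case: (f (lsubmx z)) zf => [r||//]; rewrite ?lte_fin => zr.
    by exists ((height z + r) / 2); rewrite ?lte_fin; lra.
  by exists (height z + 1); rewrite ?ltry //; lra.
have [V Vz fV] := flsc _ _ cf.
have [y [/epiE fy [Vy yc]]] : epi f `&` [set y | V (lsubmx y) /\ height y < c] !=set0.
  apply: clz; apply: filterI; first exact: continuous_lsubmx.
  exact: (cvgr_lt _ (@height_continuous _ _ z)).
have := lt_le_trans (fV _ Vy) fy.
by rewrite lte_fin => /lt_trans/(_ yc); rewrite ltxx.
Qed.

(** A sequence along which [f] tends to [-oo] would accumulate at a point where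
lower semicontinuity forces the value [-oo]. *)
Lemma lsc_compact_lower_bound (R : realType) (T : topologicalType)
    (f : T -> \bar R) (K : set T) :
  (forall x, f x != -oo%E) -> lower_semicontinuous f -> compact K ->
  exists m : R, forall x, K x -> (m%:E <= f x)%E.
Proof.
move=> fNy flsc cK; apply: contrapT => nom.
have /choice[u uP] : forall k : nat, exists x, K x /\ (f x < (- k%:R)%:E)%E.
  move=> k; apply: contrapT => nox; apply: nom; exists (- k%:R) => x Kx.
  by rewrite leNgt; apply/negP => fx; apply: nox; exists x.
have [p _ cl] := compact_seq_cluster cK (fun k => (uP k).1).
have [c cf] : exists c : R, (c%:E < f p)%E.
  case: (f p) (fNy p) => [r|_|//]; last by exists 0; rewrite ltry.
  by exists (r - 1); rewrite lte_fin; lra.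
have [V Vp fV] := flsc _ _ cf.
have [N _ NP] := nbhs_infty_ger (- c).
have [k Nk Vk] := cl _ Vp N.
have := lt_trans (fV _ Vk) (uP k).2.
by rewrite lte_fin; have := NP k Nk; rewrite /=; lra.
Qed.

(** * Minimizing on a spherical shell *)

(** In the space of the epigraph, [f x + B * (|x| ^ 2 - c) ^ 2] becomes this
polynomial, whose linear part in the height carries [f]. *)
Definition shell_cost (R : realType) n (B c : R) (z : 'rV[R]_(n + 1)) : R :=
  height z + B * (dotv (lsubmx z) (lsubmx z) - c) ^+ 2.

Definition shell_grad (R : realType) n (B c : R) (z : 'rV[R]_(n + 1)) :
    'rV[R]_(n + 1) :=
  vpair ((4 * B * (dotv (lsubmx z) (lsubmx z) - c)) *: lsubmx z) 1.

Lemma sqr_lsubmx_continuous (R : realType) n :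
  continuous (fun z : 'rV[R]_(n + 1) => dotv (lsubmx z) (lsubmx z)).
Proof.
by move=> z; apply: (@cvg_dotv _ _ _ lsubmx lsubmx); exact: continuous_lsubmx.
Qed.

Lemma shell_defect_continuous (R : realType) n (c : R) :
  continuous (fun z : 'rV[R]_(n + 1) => dotv (lsubmx z) (lsubmx z) - c).
Proof.
move=> z; apply: (@continuousB _ _ _ (fun z => dotv (lsubmx z) (lsubmx z)) (fun=> c)).
  exact: sqr_lsubmx_continuous.
exact: cst_continuous.
Qed.

Lemma shell_cost_continuous (R : realType) n (B c : R) :
  continuous (@shell_cost R n B c).
Proof.
move=> z; apply: (@continuousD _ _ _ (@height R n)
    (fun y => B * (dotv (lsubmx y) (lsubmx y) - c) ^+ 2)).
  exact: height_continuous.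
apply: (@continuousM _ _ (fun=> B) (fun y => (dotv (lsubmx y) (lsubmx y) - c) ^+ 2)).
  exact: cst_continuous.
apply: (@continuousM _ _ (fun y => dotv (lsubmx y) (lsubmx y) - c)
    (fun y => dotv (lsubmx y) (lsubmx y) - c)); exact: shell_defect_continuous.
Qed.

Lemma shell_grad_continuous (R : realType) n (B c : R) :
  continuous (@shell_grad R n B c).
Proof.
(* the vector [(x, 0)] is written [z - height z *: (0, 1)], so that continuity
   follows from that of the vector operations *)
pose s (z : 'rV[R]_(n + 1)) := 4 * B * (dotv (lsubmx z) (lsubmx z) - c).
pose b (z : 'rV[R]_(n + 1)) := z - height z *: vpair 0 1.
have -> : @shell_grad R n B c = fun z => s z *: b z + vpair 0 1.
  apply/funext => z; rewrite /shell_grad.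
  have -> : b z = vpair (lsubmx z) 0.
    by rewrite /b -{1}[z]vpairK vpairZ vpairB scaler0 subr0 mulr1 subrr.
  rewrite vpairZ mulr0 /vpair add_row_mx addr0.
  by congr row_mx; apply/rowP => i; rewrite !mxE add0r.
have cs : continuous s.
  move=> z; apply: (@continuousM _ _ (fun=> 4 * B)
    (fun y => dotv (lsubmx y) (lsubmx y) - c)).
    exact: cst_continuous.
  exact: shell_defect_continuous.
have cb : continuous b.
  move=> z; apply: (@continuousB _ _ _ id (fun y => height y *: vpair 0 1)).
    exact: cvg_id.
  by apply: continuousZr_tmp; exact: height_continuous.
move=> z; apply: (@continuousD _ _ _ (fun y => s y *: b y) (fun=> vpair 0 1)).
  by apply: continuousZ; [exact: cs|exact: cb].
exact: cst_continuous.
Qed.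

(** With [x + d] the new point, [p = dotv x d], [q = dotv d d] and
[t = |x| ^ 2 - c], the defect becomes [t + 2 p + q]; expanding its square leaves
terms in [t q] and [(2 p + q) ^ 2], which are of the order of [q] when
[q <= 1]. *)
Lemma shell_cost_upper_gradient (R : realType) n (B c : R) (z : 'rV[R]_(n + 1)) :
  0 <= B -> upper_gradient (@shell_cost R n B c) z (shell_grad B c z).
Proof.
move=> B0; rewrite -[z]vpairK; move: (lsubmx z) (height z) => {z} x a.
set z := vpair x a; set t := dotv x x - c.
pose L := (n%:R * `|x|) ^+ 2 : R.
apply: (@upper_gradient_quadratic _ _ _ _ _ (B * (2 * `|t| + 8 * L + 2))).
have near1 : \forall w \near z, dotv (w - z) (w - z) < 1.
  have cB : {for z, continuous (fun y : 'rV[R]_(n + 1) => y - z)}.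
    by apply: (@continuousB _ _ _ id (fun=> z));
      [exact: cvg_id|exact: cst_continuous].
  by apply: (cvgr_lt _ (cvg_dotv cB cB)); rewrite /= subrr dotv0l.
near=> w.
have : dotv (w - z) (w - z) < 1 by near: w.
rewrite -[w]vpairK; move: (lsubmx w) (height w) => y b.
rewrite /shell_cost /shell_grad /z vpairB !dotv_vpair !lsubmx_vpair !height_vpair.
rewrite mul1r dotvZl -/t.
have -> : y = x + (y - x) by rewrite addrC subrK.
move: (y - x) => {y} d; rewrite [x + d - x]addrAC subrr add0r.
rewrite !(dotvDl, dotvDr) (dotvC d x).
set q := dotv d d; set p := dotv x d; set h := b - a => qh1.
have q0 : 0 <= q by exact: dotv_ge0.
have hh : 0 <= h * h by rewrite -expr2 sqr_ge0.
have L0 : 0 <= L by exact: sqr_ge0.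
have pq : p ^+ 2 <= L * q.
  rewrite /q -sqr_enorm -exprMn -real_normK ?num_real //.
  rewrite ler_pXn2r ?nnegrE ?mulr_ge0 ?enorm_ge0 //.
  rewrite (le_trans (dotv_le _ _)) // mulrA ler_wpM2l ?mulr_ge0 //.
  exact: norm_le_enorm.
have qq : q ^+ 2 <= q by rewrite expr2 ler_piMl //; lra.
have tq : t * q <= `|t| * q by rewrite ler_wpM2r // ler_norm.
have -> : dotv x x + p + (p + q) - c = t + (2 * p + q) by rewrite /t; lra.
have key : B * (2 * (t * q) + (2 * p + q) ^+ 2) <=
    B * ((2 * `|t| + 8 * L + 2) * (q + h * h)).
  rewrite ler_wpM2l //.
  have s1 : (2 * p + q) ^+ 2 <= 8 * p ^+ 2 + 2 * q ^+ 2.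
    have := sqr_ge0 (2 * p - q); rewrite !expr2; lra.
  have s2 : 0 <= (2 * `|t| + 8 * L + 2) * (h * h).
    by rewrite mulr_ge0 // !addr_ge0 // mulr_ge0.
  lra.
move: key; rewrite !expr2 /h; lra.
Unshelve. all: by end_near. Qed.

(** The weight [B] makes the cost on the boundary of the shell larger than the
value [f x0] taken at [x0], on its central sphere, so the minimum is attained in the interior,
where it is a local minimum over [epi f] and the cylinder above [S]. *)
Lemma shell_minimizer (R : realType) n (f : 'rV[R]_n -> \bar R)
    (S : set 'rV[R]_n) (x0 : 'rV[R]_n) :
  (forall x, f x != -oo%E) -> lower_semicontinuous f -> closed S ->
  dom f x0 -> S x0 ->
  exists B z, let c := dotv x0 x0 in
    [/\ 0 <= B, S (lsubmx z), f (lsubmx z) = (height z)%:E,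
        c - 1 < dotv (lsubmx z) (lsubmx z) &
        \forall y \near z, epi f y -> S (lsubmx y) ->
          shell_cost B c z <= shell_cost B c y].
Proof.
move=> fNy flsc clS fx0 Sx0.
have [a0 fa0] : exists a0 : R, f x0 = a0%:E.
  move: fx0; rewrite /dom /=.
  by case: (f x0) (fNy x0) => [a0|//|//] _ _; exists a0.
pose c := dotv x0 x0; pose r := Num.sqrt (c + 1).
have near_sphere (x : 'rV[R]_n) : dotv x x <= c + 1 -> `|x| <= r.
  by move=> xc; rewrite (le_trans (norm_le_enorm x)) // ler_wsqrtr.
have [m mf] := lsc_compact_lower_bound fNy flsc (@compact_ball R n 0 r).
have ma0 : m <= a0.
  rewrite -lee_fin -fa0; apply: mf.
  by rewrite /= subr0 near_sphere // /c; lra.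
pose B := a0 - m + 1.
have B0 : 0 < B by rewrite /B; lra.
pose defect (z : 'rV[R]_(n + 1)) := dotv (lsubmx z) (lsubmx z) - c.
pose A := epi f `&` (lsubmx @^-1` S) `&` [set z | `|defect z| <= 1]
  `&` [set z | height z <= a0].
have Am z : A z -> m <= height z.
  move=> [[[/epiE fz _] dz] _]; rewrite -lee_fin (le_trans _ fz) //; apply: mf.
  rewrite /= subr0 near_sphere //.
  by move: dz; rewrite /= ler_norml /defect => /andP[_]; lra.
have cA : compact A.
  apply: bounded_closed_compact.
    exists (Num.max r (`|m| + `|a0|)); split; first exact: num_real.
    move=> M; rewrite gt_max => /andP[rM maM] z Az /=.
    have mz := Am z Az; have [[_ dz] /= za] := Az.
    rewrite -[z]vpairK; apply: norm_vpair.
      rewrite (le_trans (near_sphere _ _)) ?(ltW rM) //.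
      by move: dz; rewrite /= ler_norml /defect => /andP[_]; lra.
    apply: (le_trans _ (ltW maM)); rewrite ler_norml.
    have := ler_norm a0; have := ler_norm (- m); have := normr_ge0 m.
    have := normr_ge0 a0; rewrite normrN => *; apply/andP; split; lra.
  have dc : continuous (fun z => `|defect z|).
    move=> z; apply: (@continuous_comp _ _ _ defect).
      exact: shell_defect_continuous.
    exact: norm_continuous.
  apply: closedI; last exact: closed_sublevel (@height_continuous R n).
  apply: closedI; last exact: closed_sublevel dc.
  apply: closedI; first exact: epi_closed.
  by apply: preimage_closed => // z _; exact: continuous_lsubmx.
have A0 : A (vpair x0 a0).
  rewrite /A /defect /= lsubmx_vpair height_vpair subrr normr0.
  by split=> //; split=> //; split=> //; exists x0, a0; rewrite fa0.
have [|//||z /set_mem Az zmin] := @compact_EVT_min _ R (@shell_cost R n B c) A.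
  - by exists (vpair x0 a0).
  - by apply: continuous_subspaceT; exact: shell_cost_continuous.
have {}zmin y : A y -> shell_cost B c z <= shell_cost B c y.
  by move=> /mem_set; exact: zmin.
have za0 : shell_cost B c z <= a0.
  apply: (le_trans (zmin _ A0)).
  by rewrite /shell_cost lsubmx_vpair height_vpair subrr expr0n mulr0 addr0.
have := Am z Az; have [[[/epiE fz Sz] dz] /= hz] := Az.
move=> mz.
have d1 : `|defect z| < 1.
  rewrite lt_neqAle dz andbT; apply/eqP => d1.
  move: za0; rewrite /shell_cost -/(defect z) -real_normK ?num_real // d1 expr1n.
  rewrite /B; lra.
have fzE : f (lsubmx z) = (height z)%:E.
  case E : (f (lsubmx z)) fz (fNy (lsubmx z)) => [b|//|//].
  rewrite lee_fin => bz _; congr _%:E; apply/eqP; rewrite eq_le bz /=.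
  have : shell_cost B c z <= shell_cost B c (vpair (lsubmx z) b).
    apply: zmin; rewrite /A /defect /= lsubmx_vpair height_vpair.
    split; last exact: le_trans hz.
    by split=> //; split=> //; exists (lsubmx z), b; rewrite E.
  by rewrite /shell_cost lsubmx_vpair height_vpair lerD2r.
exists B, z; split=> //; first exact: ltW.
  by move: d1; rewrite ltr_norml /defect /c => /andP[+ _]; lra.
near=> y => fy Sy.
have [ya|ya] := leP (height y) a0; last first.
  rewrite (le_trans za0) // (le_trans (ltW ya)) // /shell_cost lerDl.
  by rewrite mulr_ge0 ?sqr_ge0 // ltW.
apply: zmin; split=> //; split=> //; rewrite /= ltW //; near: y.
apply: (cvgr_lt _ _ _ d1); apply: (@continuous_comp _ _ _ defect).
  exact: shell_defect_continuous.
exact: norm_continuous.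
Unshelve. all: by end_near. Qed.

(** A vanishing multiplier on the cost would produce opposite horizon and
normal directions, which the qualification condition forbids at points of norm
more than [r]; dividing by a positive one gives the tangency relation, because
the gradient of the cost in [x] is a multiple of [x]. *)
Lemma tangency_point_beyond (R : realType) n (f : 'rV[R]_n -> \bar R)
    (S : set 'rV[R]_n) (r : R) (x0 : 'rV[R]_n) :
  (forall x, f x != -oo%E) -> lower_semicontinuous f -> closed S ->
  (forall x, ((dom f `&` S) `\` eball r) x ->
     horizon_subdiff f x `&` [set - v | v in normal_cone x S] = [set 0]) ->
  0 < r -> r ^+ 2 + 1 <= dotv x0 x0 -> dom f x0 -> S x0 ->
  exists2 x, tangency_variety f S x & dotv x0 x0 - 1 < dotv x x.
Proof.
move=> fNy flsc clS qc r0 rx0 fx0 Sx0.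
have [B [z [B0 Sz fz far zmin]]] := shell_minimizer fNy flsc clS fx0 Sx0.
set c := dotv x0 x0 in rx0 far zmin.
have clS' : closed [set y : 'rV[R]_(n + 1) | S (lsubmx y)].
  by apply: (@preimage_closed _ _ lsubmx) => // y _; exact: continuous_lsubmx.
have Ez : epi f z by apply/epiE; rewrite fz.
have [lam [om [lam0 lam1 NE /normal_cylinder[NS om0]]]] :=
  fritz_john (epi_closed flsc) clS' (@shell_cost_continuous R n B c) Ez Sz
    (fun y => shell_cost_upper_gradient c y B0)
    (@shell_grad_continuous R n B c z) zmin.
set x := lsubmx z in Sz fz far NS.
have domx : dom f x by rewrite /dom /= fz ltry.
have xr : ~ eball r x.
  rewrite /eball /= => xr; have : enorm x ^+ 2 <= r ^+ 2.
    by rewrite ler_pXn2r ?nnegrE ?enorm_ge0 // ltW.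
  rewrite sqr_enorm; lra.
set v := lsubmx om in NS.
set mu := 4 * B * (dotv x x - c).
have {}NE : normal_cone (vpair x (fine (f x))) (epi f)
    (vpair (- ((lam * mu) *: x) - v) (- lam)).
  rewrite fz /= vpairK; move: NE; congr normal_cone.
  rewrite -[om]vpairK om0 -scaleNr vpairZ vpairB -/x -/v -/mu.
  by rewrite subr0 mulr1 scaleNr scalerA.
have omE : om = vpair v 0 by rewrite -[om]vpairK om0.
have lam_gt0 : 0 < lam.
  rewrite lt_neqAle lam0 andbT eq_sym; apply/eqP => lamE.
  have : (horizon_subdiff f x `&` [set - v | v in normal_cone x S]) (- v).
    split; last by exists v.
    by split=> //; move: NE; rewrite lamE mul0r scale0r !oppr0 add0r.
  rewrite qc //= => v0.
  move: lam1; rewrite lamE omE -[v]opprK v0 oppr0.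
  have -> : vpair 0 0 = 0 :> 'rV[R]_(n + 1) by exact: row_mx0.
  by rewrite normr0 addr0 => /eqP; rewrite eq_sym oner_eq0.
exists x => //; split=> //; exists mu, (- (mu *: x) - lam^-1 *: v), (lam^-1 *: v).
have lam_n0 : lam != 0 by rewrite lt0r_neq0.
split.
- split=> //.
  have -> : vpair (- (mu *: x) - lam^-1 *: v) (-1) =
      lam^-1 *: vpair (- ((lam * mu) *: x) - v) (- lam).
    rewrite vpairZ mulrN mulVf //; congr vpair.
    by rewrite scalerBr scalerN scalerA mulrA mulVf // mul1r.
  by apply: normal_coneZ; rewrite ?invr_gt0.
- by apply: normal_coneZ; rewrite ?invr_gt0.
- by rewrite subrK addNr.
Qed.

Theorem lemma3p8 (R : realType) (n : nat)
    (f : 'rV[R]_n -> \bar R) (S : set 'rV[R]_n)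
    (f_ninfty : forall x, f x != -oo%E)
    (f_lsc : lower_semicontinuous f)
    (f_sa : semialgebraic_fun f)
    (S_closed : closed S)
    (S_sa : semialgebraic S)
    (domS_nonempty : dom f `&` S !=set0)
    (domS_unbounded : ~ bounded_set (dom f `&` S))
    (qc : QC_infty f S) :
  tangency_variety f S !=set0 /\ ~ bounded_set (tangency_variety f S).
Proof.
have [r r0 qcr] := qc.
have far (M : R) : exists2 x, tangency_variety f S x & M < dotv x x.
  have [x0 [[fx0 Sx0] x0M]] : exists x0, (dom f `&` S) x0 /\
      r ^+ 2 + 1 + `|M| <= dotv x0 x0.
    apply: contrapT => nox0; apply: domS_unbounded.
    exists (Num.sqrt (r ^+ 2 + 1 + `|M|)); split; first exact: num_real.
    move=> N sN x xS /=; apply: (le_trans (norm_le_enorm x)).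
    apply: (le_trans _ (ltW sN)); rewrite ler_wsqrtr // leNgt; apply/negP => xM.
    by apply: nox0; exists x; split=> //; exact: ltW.
  have [|x Tx cx] := tangency_point_beyond f_ninfty f_lsc S_closed qcr r0 _ fx0 Sx0.
    by apply: (le_trans _ x0M); rewrite lerDl.
  exists x => //; apply: le_lt_trans cx.
  have := ler_norm M; have := sqr_ge0 r; lra.
split; first by have [x Tx _] := far 0; exists x.
move=> [M [_ TM]].
have [x Tx xM] := far (n%:R * ((`|M| + 1) * (`|M| + 1))).
have xM1 : `|x| <= `|M| + 1.
  by apply: TM => //; rewrite (le_lt_trans (ler_norm M)) // ltrDl.
have : dotv x x <= n%:R * (`|x| * `|x|).
  exact: le_trans (ler_norm _) (dotv_le _ _).
have : n%:R * (`|x| * `|x|) <= n%:R * ((`|M| + 1) * (`|M| + 1)).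
  by rewrite ler_wpM2l // ler_pM.
lra.
Qed.
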